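(* Let $L$ be a modal logic and let $\mathcal{C}$ be a class of Kripke models such that $L$ is sound and complete with respect to $\mathcal{C}$ (i.e. $L\vdash\varphi$ iff $\varphi$ is true at every world of every model in $\mathcal{C}$). If $\mathcal{C}$ enjoys $n$-IP for some natural number $n$, then $L$ has the uniform Lyndon interpolation property (ULIP).
   Context: Modal formulas are built from propositional variables, $\bot$, $\land,\lor,\neg,\to$ and $\Box$ ($\Diamond\varphi:=\neg\Box\neg\varphi$). Positive/negative variables: $v^+(p)=\{p\}$, $v^-(p)=\emptyset$; $v^\circ(\bot)=\emptyset$; $v^\circ(\varphi\ast\psi)=v^\circ(\varphi)\cup v^\circ(\psi)$ for $\ast\in\{\land,\lor\}$; $v^+(\neg\varphi)=v^-(\varphi)$, $v^-(\neg\varphi)=v^+(\varphi)$; $v^+(\varphi\to\psi)=v^-(\varphi)\cup v^+(\psi)$, $v^-(\varphi\to\psi)=v^+(\varphi)\cup v^-(\psi)$; $v^\circ(\Box\varphi)=v^\circ(\varphi)$. The modal depth $d(\varphi)$ is the maximal nesting of $\Box$. A Kripke frame is $(W,R)$ with $W\neq\emptyset$ and $R$ reflexive and transitive; a Kripke model $(W,R,\Vdash)$ adds a valuation with the usual clauses, $\Box\varphi$ true at $x$ iff $\varphi$ true at all $y$ with $xRy$. For finite sets $P^+,P^-$ of variables, a $(P^+,P^-)$-formula is one with $v^\circ(\varphi)\subseteq P^\circ$ for $\circ\in\{+,-\}$. For models $M_0,M_1$ and worlds $w_0,w_1$, write $(M_0,w_0)\xrightarrow[n]{(P^+,P^-)}(M_1,w_1)$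 iff every $(P^+,P^-)$-formula $\varphi$ with $d(\varphi)\le n$ true at $(M_0,w_0)$ is true at $(M_1,w_1)$. A map $f:W\to W'$ between frames is a p-morphism iff $xRy$ implies $f(x)R'f(y)$, and $f(x)R'w$ implies there is $z$ with $xRz$ and $f(z)=w$. A class $\mathcal{C}$ of Kripke models enjoys $n$-IP iff for all finite $P^+,P^-$, all $M_0=(W_0,R_0,\Vdash_0)$, $M_1=(W_1,R_1,\Vdash_1)$ in $\mathcal{C}$ and $w_0\in W_0$, $w_1\in W_1$ with $(M_0,w_0)\xrightarrow[n]{(P^+,P^-)}(M_1,w_1)$, there exist a Kripke frame $(W^*,R^* )$, $w^*\in W^*$, and p-morphisms $f_0:W^*\to W_0$, $f_1:W^*\to W_1$ such that: all Kripke models based on $(W^*,R^* )$ are in $\mathcal{C}$; $f_0(w^* )=w_0$, $f_1(w^* )=w_1$; and for every $x^*\in W^*$, $(M_0,f_0(x^* ))\xrightarrow[0]{(P^+,P^-)}(M_1,f_1(x^* ))$. A logic $L$ has ULIP iff for every formula $\varphi$ and finite sets $P^+,P^-$ there is $\theta$ with $L\vdash\varphi\to\theta$, $v^\circ(\theta)\subseteq v^\circ(\varphi)\setminus P^\circ$ for $\circ\in\{+,-\}$, and $L\vdash\theta\to\psi$ for every $\psi$ with $L\vdash\varphi\to\psi$ and $v^\circ(\psi)\cap P^\circ=\emptyset$ for $\circ\in\{+,-\}$. *)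

(* Defs.v *)
From mathcomp Require Import all_boot finmap.

Set Implicit Arguments.
Unset Strict Implicit.
Unset Printing Implicit Defensive.

Local Open Scope fset_scope.

Inductive form : Type :=
| Var of nat
| Bot
| And of form & form
| Or of form & form
| Neg of form
| Imp of form & form
| Box of form.

Fixpoint vpos (phi : form) : {fset nat} :=
  match phi with
  | Var p => [fset p]
  | Bot => fset0
  | And a b | Or a b => vpos a `|` vpos b
  | Neg a => vneg a
  | Imp a b => vneg a `|` vpos b
  | Box a => vpos a
  end
with vneg (phi : form) : {fset nat} :=
  match phi with
  | Var _ | Bot => fset0
  | And a b | Or a b => vneg a `|` vneg b
  | Neg a => vpos a
  | Imp a b => vpos a `|` vneg b
  | Box a => vneg a
  end.

Fixpoint depth (phi : form) : nat :=
  match phi with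
  | Var _ | Bot => 0
  | And a b | Or a b | Imp a b => maxn (depth a) (depth b)
  | Neg a => depth a
  | Box a => (depth a).+1
  end.

Fixpoint subst (s : nat -> form) (phi : form) : form :=
  match phi with
  | Var p => s p
  | Bot => Bot
  | And a b => And (subst s a) (subst s b)
  | Or a b => Or (subst s a) (subst s b)
  | Neg a => Neg (subst s a)
  | Imp a b => Imp (subst s a) (subst s b)
  | Box a => Box (subst s a)
  end.

(* Boolean evaluation in which boxed formulas count as atoms: [e] gives the
   values of variables and [g a] the value of [Box a]. *)
Fixpoint bool_eval (e : nat -> bool) (g : form -> bool) (phi : form) : bool :=
  match phi with
  | Var p => e p
  | Bot => false
  | And a b => bool_eval e g a && bool_eval e g b
  | Or a b => bool_eval e g a || bool_eval e g b
  | Neg a => ~~ bool_eval e g a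
  | Imp a b => bool_eval e g a ==> bool_eval e g b
  | Box a => g a
  end.

Definition tautology (phi : form) : Prop := forall e g, bool_eval e g phi.

(* A logic is the set of its theorems: [L phi] reads "L proves phi".  This is
   the general textbook notion of modal logic; normality (axiom K and
   necessitation) is not imposed, it follows from soundness and completeness
   with respect to a class of Kripke models. *)
Record modal_logic (L : form -> Prop) : Prop := ModalLogic {
  logic_taut : forall phi, tautology phi -> L phi;
  logic_mp : forall phi psi, L (Imp phi psi) -> L phi -> L psi;
  logic_subst : forall s phi, L phi -> L (subst s phi)
}.

Record frame : Type := Frame {
  world :> Type;
  acc : world -> world -> Prop;
  frame_nonempty : inhabited world;
  acc_refl : forall x, acc x x;
  acc_trans : forall x y z, acc x y -> acc y z -> acc x z
}.

Record model : Type := Model {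
  frame_of :> frame;
  val : frame_of -> nat -> Prop
}.

Fixpoint forces (M : model) (x : M) (phi : form) : Prop :=
  match phi with
  | Var p => val x p
  | Bot => False
  | And a b => forces x a /\ forces x b
  | Or a b => forces x a \/ forces x b
  | Neg a => ~ forces x a
  | Imp a b => forces x a -> forces x b
  | Box a => forall y : M, acc x y -> forces y a
  end.

Definition sound_complete (L : form -> Prop) (C : model -> Prop) : Prop :=
  forall phi, L phi <-> (forall M : model, C M -> forall x : M, forces x phi).

Definition signed_formula (Pp Pn : {fset nat}) (phi : form) : Prop :=
  vpos phi `<=` Pp /\ vneg phi `<=` Pn.

Definition arrow (n : nat) (Pp Pn : {fset nat})
    (M0 : model) (w0 : M0) (M1 : model) (w1 : M1) : Prop :=
  forall phi, signed_formula Pp Pn phi -> depth phi <= n ->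
    forces w0 phi -> forces w1 phi.

Definition p_morphism (F G : frame) (f : F -> G) : Prop :=
  (forall x y, acc x y -> acc (f x) (f y)) /\
  (forall x w, acc (f x) w -> exists z, acc x z /\ f z = w).

Definition nIP (n : nat) (C : model -> Prop) : Prop :=
  forall (Pp Pn : {fset nat}) (M0 M1 : model), C M0 -> C M1 ->
  forall (w0 : M0) (w1 : M1), arrow n Pp Pn w0 w1 ->
  exists (F : frame) (w : F) (f0 : F -> M0) (f1 : F -> M1),
    p_morphism f0 /\ p_morphism f1 /\
    (forall v : F -> nat -> Prop, C (Model v)) /\
    f0 w = w0 /\ f1 w = w1 /\
    (forall x : F, arrow 0 Pp Pn (f0 x) (f1 x)).

Definition ULIP (L : form -> Prop) : Prop :=
  forall (phi : form) (Pp Pn : {fset nat}),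
  exists theta : form,
    L (Imp phi theta) /\
    vpos theta `<=` vpos phi `\` Pp /\
    vneg theta `<=` vneg phi `\` Pn /\
    (forall psi, L (Imp phi psi) ->
       vpos psi `&` Pp = fset0 -> vneg psi `&` Pn = fset0 ->
       L (Imp theta psi)).

(* Main.v *)
(** For finite P+, P- and fixed n, whether every (P+,P-)-formula of depth at
    most n is transferred from one world to another is decided by finitely
    many formulas [l].  With v°(phi) \ P° in place of P°, let theta be the conjunction
    of all disjunctions of sublists of [l] that are implied by phi.  If theta
    does not imply psi, pick (M1, w1) satisfying theta but not psi.  The
    disjunction of the members of [l] that fail at w1 is not implied by phi, so
    some (M0, w0) satisfies phi and refutes all of them, whence
    (M0, w0) --> (M1, w1).  On the frame given by n-IP, a valuation
    mixing those of M0 and M1 satisfies phi and refutes psi. *)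

From mathcomp Require Import all_boot finmap.
From Stdlib Require Import List Classical.
Require Import Defs.

Set Implicit Arguments.
Unset Strict Implicit.
Unset Printing Implicit Defensive.

Local Open Scope fset_scope.

(** * Finite conjunctions, disjunctions and sublists *)

Definition conj_list (s : list form) : form := fold_right And (Neg Bot) s.

Definition disj_list (s : list form) : form := fold_right Or Bot s.

Fixpoint sublists (T : Type) (l : list T) : list (list T) :=
  if l is x :: l' then map (cons x) (sublists l') ++ sublists l' else [:: [::]].

Lemma forces_conj_list (M : model) (x : M) s :
  forces x (conj_list s) <-> forall a, In a s -> forces x a.
Proof.
elim: s => [|b s IH] /=; first by split=> // _ H.
rewrite IH; split=> [[xb xs] a [<-//|/xs]//|H].
by split=> [|a sa]; apply: H; [left|right].
Qed.

Lemma forces_disj_list (M : model) (x : M) s :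
  forces x (disj_list s) <-> exists a, In a s /\ forces x a.
Proof.
elim: s => [|b s IH] /=; first by split=> // -[a []].
rewrite IH; split=> [[xb|[a [sa xa]]]|[a [[->|sa] xa]]].
- by exists b; split; first left.
- by exists a; split; first right.
- by left.
- by right; exists a.
Qed.

(** [P] need not be decidable, so the selected list cannot be computed. Excluded middle at each
    entry still locates it among the finitely many sublists, which keeps the formulas built from it
    inside a list fixed in advance. *)
Lemma sublists_filter (T : Type) (P : T -> Prop) (l : list T) :
  exists s, In s (sublists l) /\ forall x, In x s <-> In x l /\ P x.
Proof.
elim: l => [|y l [s [sl sP]]] /=.
  by exists [::]; split=> [|x]; [left|split=> [|[]]].
have [Py|nPy] := classic (P y).
  exists (y :: s); split=> [|x /=].
    by apply/in_app_iff; left; apply: in_map.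
  rewrite sP; split=> [[<-|[lx Px]]|[[->|lx] Px]]; by [split; auto|auto].
exists s; split=> [|x]; first by apply/in_app_iff; right.
rewrite sP; split=> [[lx Px]|[[yx|lx] Px]]; [by split; auto| |by split].
by case: nPy; rewrite yx.
Qed.

Lemma in_sublists (T : Type) (l s : list T) x :
  In s (sublists l) -> In x s -> In x l.
Proof.
elim: l s => [|y l IH] s /=; first by case=> // <-.
move=> /in_app_iff [/in_map_iff [t [<- tl]] [->|xt]|sl xs]; first by left.
  by right; apply: IH tl xt.
by right; apply: IH sl xs.
Qed.

Lemma conj_list_signed Pp Pn s :
  (forall a, In a s -> signed_formula Pp Pn a) ->
  signed_formula Pp Pn (conj_list s).
Proof.
elim: s => [|b s IH] H; first by split; rewrite /= fsub0set.
have [bp bn] := H b (or_introl erefl).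
have [|sp sn] := IH; first by move=> a sa; apply: H; right.
by split; rewrite /= fsubUset ?bp ?bn.
Qed.

Lemma disj_list_signed Pp Pn s :
  (forall a, In a s -> signed_formula Pp Pn a) ->
  signed_formula Pp Pn (disj_list s).
Proof.
elim: s => [|b s IH] H; first by split; rewrite /= fsub0set.
have [bp bn] := H b (or_introl erefl).
have [|sp sn] := IH; first by move=> a sa; apply: H; right.
by split; rewrite /= fsubUset ?bp ?bn.
Qed.

(** * A finite basis deciding signed transfer up to a given depth *)

Definition transfers (l : list form) (M0 : model) (w0 : M0)
    (M1 : model) (w1 : M1) : Prop :=
  forall a, In a l -> forces w0 a -> forces w1 a.

Definition literals (Pp Pn : {fset nat}) : list form :=
  map Var (enum_fset Pp) ++ map (fun p => Neg (Var p)) (enum_fset Pn).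

Definition Dia (a : form) : form := Neg (Box (Neg a)).

Lemma forces_Dia (M : model) (x : M) a :
  forces x (Dia a) <-> exists y, acc x y /\ forces y a.
Proof.
split=> /= [nB|[y [xy ya]] /(_ y xy)//].
by apply: NNPP => nE; apply: nB => y xy ya; apply: nE; exists y.
Qed.

(** One-sided analogue of characteristic formulas: the boxed disjunctions yield the back condition
    of a directed simulation, the diamonds of conjunctions the forth condition. *)
Definition next_basis (Pp Pn : {fset nat}) (l : list form) : list form :=
  literals Pp Pn ++
  map (fun s => Box (disj_list s)) (sublists l) ++
  map (fun s => Dia (conj_list s)) (sublists l).

Fixpoint basis (Pp Pn : {fset nat}) (n : nat) : list form :=
  if n is n'.+1 then next_basis Pp Pn (basis Pp Pn n') else literals Pp Pn.

Lemma mem_In (T : eqType) (x : T) (s : list T) : x \in s <-> In x s.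
Proof.
elim: s => [|y s IH] //=; rewrite inE; split.
  by case/orP=> [/eqP->|/IH]; [left|right].
by case=> [->|/IH ->]; rewrite ?eqxx ?orbT.
Qed.

Lemma literals_signed Pp Pn a :
  In a (literals Pp Pn) -> signed_formula Pp Pn a.
Proof.
by move=> /in_app_iff [] /in_map_iff [p [<- /mem_In pP]];
  split; rewrite /= ?fsub0set ?fsub1set.
Qed.

Lemma basis_signed Pp Pn n a : In a (basis Pp Pn n) -> signed_formula Pp Pn a.
Proof.
elim: n a => [|n IH] a; first exact: literals_signed.
move=> /in_app_iff [/literals_signed //|/in_app_iff []].
  move=> /in_map_iff [s [<- sl]].
  by apply: (@disj_list_signed Pp Pn s) => b /(in_sublists sl) /IH.
move=> /in_map_iff [s [<- sl]].
by apply: (@conj_list_signed Pp Pn s) => b /(in_sublists sl) /IH.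
Qed.

Lemma literals_basis Pp Pn n a :
  In a (literals Pp Pn) -> In a (basis Pp Pn n).
Proof. by case: n => //= n lit; apply/in_app_iff; left. Qed.

Lemma Var_literals (Pp Pn : {fset nat}) p :
  p \in Pp -> In (Var p) (literals Pp Pn).
Proof. by move=> pP; apply/in_app_iff; left; apply/in_map/mem_In. Qed.

Lemma Neg_Var_literals (Pp Pn : {fset nat}) p :
  p \in Pn -> In (Neg (Var p)) (literals Pp Pn).
Proof.
move=> pP; apply/in_app_iff; right.
by apply: (in_map (fun q => Neg (Var q))); apply/mem_In.
Qed.

Section Step.

Variables (Pp Pn : {fset nat}) (l : list form) (n : nat).
Hypothesis l_arrow : forall (M0 M1 : model) (w0 : M0) (w1 : M1),
  transfers l w0 w1 -> arrow n Pp Pn w0 w1.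

(** If no successor of [w0] worked, each would force some member of [l] that fails at [y1]. The box
    of the disjunction of these members would then hold at [w0], hence at [w1], which [y1]
    refutes. *)
Lemma next_basis_back (M0 M1 : model) (w0 : M0) (w1 y1 : M1) :
  transfers (next_basis Pp Pn l) w0 w1 -> acc w1 y1 ->
  exists y0, acc w0 y0 /\ arrow n Pp Pn y0 y1.
Proof.
move=> tr wy; have [s [sl sP]] := sublists_filter (fun a => ~ forces y1 a) l.
apply: NNPP => nE.
have: forces w1 (Box (disj_list s)).
  apply: tr => [|y0 wy0].
    apply/in_app_iff; right; apply/in_app_iff; left.
    exact: (in_map (fun s => Box (disj_list s))).
  apply: NNPP => /forces_disj_list ns; apply: nE; exists y0; split=> //.
  apply: l_arrow => a la y0a; apply: NNPP => y1a.
  by apply: ns; exists a; split=> //; apply/sP.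
by move=> /(_ y1 wy) /forces_disj_list [a [/sP []]].
Qed.

(** The conjunction of the members of [l] true at [y0] is possible at [w0], hence at [w1]; a witness
    there is the required successor. *)
Lemma next_basis_forth (M0 M1 : model) (w0 y0 : M0) (w1 : M1) :
  transfers (next_basis Pp Pn l) w0 w1 -> acc w0 y0 ->
  exists y1, acc w1 y1 /\ arrow n Pp Pn y0 y1.
Proof.
move=> tr wy; have [s [sl sP]] := sublists_filter (fun a => forces y0 a) l.
have /forces_Dia [y1 [wy1 /forces_conj_list y1s]] :
    forces w1 (Dia (conj_list s)).
  apply: tr.
    apply/in_app_iff; right; apply/in_app_iff; right.
    exact: (in_map (fun s => Dia (conj_list s))).
  by apply/forces_Dia; exists y0; split=> //; apply/forces_conj_list=> a /sP [].
exists y1; split=> //; apply: l_arrow => a la y0a.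
by apply: y1s; apply/sP.
Qed.

End Step.

(* The two conclusions are proved together since negation exchanges them. *)
Lemma basis_transfer Pp Pn n (M0 M1 : model) (w0 : M0) (w1 : M1) a :
  transfers (basis Pp Pn n) w0 w1 -> depth a <= n ->
  (signed_formula Pp Pn a -> forces w0 a -> forces w1 a) /\
  (signed_formula Pn Pp a -> forces w1 a -> forces w0 a).
Proof.
rewrite /signed_formula.
elim: n M0 M1 w0 w1 a => [|n IHn] M0 M1 w0 w1 a tr;
  elim: a => [p||a IHa b IHb|a IHa b IHb|a IHa|a IHa b IHb|a _] //=;
  rewrite ?fsubUset ?fsub1set ?geq_max.
all: try by move=> /andP [/IHa [a01 a10] /IHb [b01 b10]];
  split=> -[/andP[? ?] /andP[? ?]]; tauto.
all: try by move=> /IHa [a01 a10]; split=> -[? ?]; tauto.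
1,2: move=> _; split=> -[pP _];
  first by apply: (tr (Var p)); apply/literals_basis/Var_literals.
(* Here [p] lies in [Pn]: if it failed at [w0], the literal [Neg (Var p)] would transfer to [w1]. *)
1,2: move=> w1p; apply: NNPP;
  by move/(tr _ (literals_basis _ (Neg_Var_literals _ pP))).
have arr : forall (M0 M1 : model) (w0 : M0) (w1 : M1),
    transfers (basis Pp Pn n) w0 w1 -> arrow n Pp Pn w0 w1.
  by move=> ? ? ? ? t c sc dc; apply: (IHn _ _ _ _ _ t dc).1 sc.
rewrite ltnS => da; split=> [sa w0a y1|[san sap] w1a y0].
  move=> /(next_basis_back arr tr) [y0 [wy0 y01]].
  by apply: (y01 _ sa da); apply: w0a.
move=> /(next_basis_forth arr tr) [y1 [wy1 y01]].
(* Negation exchanges the signs and keeps the depth, so [Neg a] is a formula that passes from [y0]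
   to [y1]. *)
by apply: NNPP => y0a; apply: (y01 (Neg a)) (w1a _ wy1).
Qed.

Lemma basis_arrow Pp Pn n (M0 M1 : model) (w0 : M0) (w1 : M1) :
  transfers (basis Pp Pn n) w0 w1 -> arrow n Pp Pn w0 w1.
Proof. by move=> tr a sa da; apply: (basis_transfer tr da).1 sa. Qed.

(** * Mixing two valuations along p-morphisms *)

(** Truth is monotone in positive variables and antitone in negative ones, so one-sided comparisons
    of the valuations suffice. Negation and implication force a joint induction; at a box, one
    direction uses that [f] preserves accessibility, the other its back condition. *)
Lemma p_morphism_forces (F : frame) (v : F -> nat -> Prop) (M : model)
    (f : F -> M) a :
  p_morphism f ->
  ((forall p x, p \in vpos a -> val (f x) p -> v x p) ->
   (forall p x, p \in vneg a -> v x p -> val (f x) p) ->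
   forall x, forces (f x) a -> @forces (Model v) x a) /\
  ((forall p x, p \in vneg a -> val (f x) p -> v x p) ->
   (forall p x, p \in vpos a -> v x p -> val (f x) p) ->
   forall x, @forces (Model v) x a -> forces (f x) a).
Proof.
move=> [fhom fback].
elim: a => [p||a [a1 a2] b [b1 b2]|a [a1 a2] b [b1 b2]|a [a1 a2]
  |a [a1 a2] b [b1 b2]|a [a1 a2]] /=.
- by split=> [vp _|_ vp] x; apply: vp; rewrite inE.
- by [].
- split=> vp vn x [xa xb]; (split; [apply: a1 xa || apply: a2 xa|
    apply: b1 xb || apply: b2 xb]) => p y pa; (apply: vp || apply: vn);
    by rewrite inE pa ?orbT.
- split=> vp vn x [xa|xb]; (left; (apply: a1 xa || apply: a2 xa)) ||
    (right; (apply: b1 xb || apply: b2 xb)); move=> p y pa;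
    (apply: vp || apply: vn); by rewrite inE pa ?orbT.
- by split=> vp vn x nxa xa; apply: nxa; (apply: a2 xa || apply: a1 xa).
- split=> vp vn x xab xa.
    apply: b1; last (apply: xab; apply: a2 xa); move=> p y pa;
    (apply: vp || apply: vn); by rewrite inE pa ?orbT.
  apply: b2; last (apply: xab; apply: a1 xa); move=> p y pa;
    (apply: vp || apply: vn); by rewrite inE pa ?orbT.
- split=> vp vn x xa y.
    by move=> xy; apply: a1 => //; apply: xa; apply: fhom.
  by move=> /fback [z [xz <-]]; apply: a2 => //; apply: xa.
Qed.

(** The least valuation that meets the two lower bounds in [p_morphism_forces]: on positive
    variables of [phi] against [M0], on negative variables of [psi] against [M1]. *)
Definition mixed_val (F : frame) (M0 M1 : model) (f0 : F -> M0) (f1 : F -> M1)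
    (phi psi : form) (x : F) (p : nat) : Prop :=
  (p \in vpos phi /\ val (f0 x) p) \/ (p \in vneg psi /\ val (f1 x) p).

(** Only the upper bounds need an argument. They can fail only at a variable that is positive in
    both formulas or negative in both; there the depth 0 arrow, applied to the variable or to its
    negation, settles the matter. *)
Lemma mixed_val_forces (F : frame) (M0 M1 : model) (f0 : F -> M0)
    (f1 : F -> M1) (phi psi : form) (Qp Qn : {fset nat}) (x : F) :
  p_morphism f0 -> p_morphism f1 ->
  (forall y, arrow 0 Qp Qn (f0 y) (f1 y)) ->
  vpos phi `&` vpos psi `<=` Qp -> vneg phi `&` vneg psi `<=` Qn ->
  forces (f0 x) phi -> ~ forces (f1 x) psi ->
  ~ @forces (Model (mixed_val f0 f1 phi psi)) x (Imp phi psi).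
Proof.
move=> pm0 pm1 arr /fsubsetP subp /fsubsetP subn xphi xpsi /= H; apply: xpsi.
apply: (p_morphism_forces (mixed_val f0 f1 phi psi) psi pm1).2 (H _).
- by move=> p y pn yp; right.
- move=> p y pp [[pphi y0]|[]] //.
  apply: (arr y (Var p)) y0 => //; split; rewrite /= ?fsub0set ?fsub1set //.
  by apply: subp; rewrite inE pphi.
- apply: (p_morphism_forces (mixed_val f0 f1 phi psi) phi pm0).1 xphi.
    by move=> p y pp yp; left.
  move=> p y pn [[]|[ppsi y1]] //; apply: NNPP => y0.
  apply: (arr y (Neg (Var p))) y0 y1 => //.
  split; rewrite /= ?fsub0set ?fsub1set //.
  by apply: subn; rewrite inE pn.
Qed.

(** * The uniform interpolant *)

Lemma fsetI_sub_fsetD (A B P : {fset nat}) :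
  B `&` P = fset0 -> A `&` B `<=` A `\` P.
Proof.
move=> /fsetP BP; apply/fsubsetP => p; rewrite !inE => /andP [-> pB].
by move: (BP p); rewrite !inE pB /= => ->.
Qed.

Theorem theorem3p7 (L : form -> Prop) (C : model -> Prop) :
  modal_logic L ->
  sound_complete L C ->
  (exists n : nat, nIP n C) ->
  ULIP L.
Proof.
move=> _ LC [n ip] phi Pp Pn.
set Qp := vpos phi `\` Pp; set Qn := vneg phi `\` Pn.
pose l := basis Qp Qn n.
have [t [tl tP]] := sublists_filter (fun a => L (Imp phi a))
  (map disj_list (sublists l)).
have [tp tn] : signed_formula Qp Qn (conj_list t).
  apply: conj_list_signed => a /tP [/in_map_iff [s [<- sl]] _].
  by apply: disj_list_signed => b /(in_sublists sl) /basis_signed.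
exists (conj_list t); split; [|split=> //; split=> // psi Lpsi psip psin].
  apply/LC => M CM x xphi; apply/forces_conj_list => a /tP [_ /LC La].
  exact: La.
apply/LC => M1 CM1 w1 w1t; apply: NNPP => w1psi.
have [s [sl sP]] := sublists_filter (fun a => ~ forces w1 a) l.
have [M0 [CM0 [w0 [w0phi w0s]]]] : exists M0 : model, C M0 /\
    exists w0 : M0, forces w0 phi /\ ~ forces w0 (disj_list s).
  (* Otherwise completeness makes [phi] imply the disjunction of [s], which is then a conjunct of
     the interpolant and holds at [w1], where all its members fail. *)
  apply: NNPP => nE.
  have Ls : L (Imp phi (disj_list s)).
    apply/LC => M CM x xphi; apply: NNPP => xs.
    by apply: nE; exists M; split=> //; exists x.
  have : forces w1 (disj_list s).
    by move/forces_conj_list: w1t; apply; apply/tP; split=> //; apply: in_map.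
  by move/forces_disj_list => [a [/sP []]].
have tr : transfers l w0 w1.
  move=> a la w0a; apply: NNPP => w1a; apply: w0s.
  by apply/forces_disj_list; exists a; split=> //; apply/sP.
have [F [w [f0 [f1 [pm0 [pm1 [CF [fw0 [fw1 arr]]]]]]]]] :=
  ip _ _ _ _ CM0 CM1 _ _ (basis_arrow tr).
apply: (@mixed_val_forces F M0 M1 f0 f1 phi psi Qp Qn w) => //.
- exact: fsetI_sub_fsetD.
- exact: fsetI_sub_fsetD.
- by rewrite fw0.
- by rewrite fw1.
(* The mixed model lies in [C] because every valuation on [F] gives a member of [C], so soundness
   applies to it. *)
- by move/LC: Lpsi; apply; apply: CF.
Qed.
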